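(* Let $M$ be a compact Riemannian manifold without boundary and $\Phi:\mathbb{R}^d\times M\to M$ a $C^1$ $\mathbb{R}^d$-action on $M$, with $\dim M\geq d$. If $\Phi$ is separating and homogeneous, then $\mathcal{Z}^0(\Phi)$ is quasi-trivial, i.e., for every $\Psi\in\mathcal{Z}^0(\Phi)$ there exists a continuous map $A:M\to\mathcal{M}_{d\times d}(\mathbb{R})$ satisfying $A(x)=A(\Phi_v(x))$ for every $(v,x)\in\mathbb{R}^d\times M$ and such that $\Psi_v(x)=\Phi_{A(x)v}(x)$ for every $(v,x)\in\mathbb{R}^d\times M$.
   Context: A continuous $\mathbb{R}^d$-action on $M$ is a continuous map $\Phi:\mathbb{R}^d\times M\to M$ such that, with $\Phi_v=\Phi(v,\cdot)$, $\Phi_0=\mathrm{id}$, each $\Phi_v$ is a homeomorphism, and $\Phi_{v+u}=\Phi_v\circ\Phi_u$ for all $u,v\in\mathbb{R}^d$. It is a $C^1$ action if the map $\Phi$ is $C^1$. The orbit of $x$ is $Orb(x,\Phi)=\{\Phi_v(x):v\in\mathbb{R}^d\}$. $\Phi$ is separating if there exists $\delta>0$ such that for all $x,y\in M$: if $d(\Phi_v(x),\Phi_v(y))<\delta$ for all $v\in\mathbb{R}^d$, then $y\in Orb(x,\Phi)$ (here $d(\cdot,\cdot)$ is the distance on $M$). A $C^1$ $\mathbb{R}^d$-action is homogeneous (or locally free) if all its orbits are immersed submanifolds of $M$ of dimension $d$. $\mathcal{Z}^0(\Phi)$ is the set of continuous $\mathbb{R}^d$-actions $\Psi:\mathbb{R}^d\times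 M\to M$ with $\Phi_v\circ\Psi_u=\Psi_u\circ\Phi_v$ for all $u,v\in\mathbb{R}^d$. $\mathcal{M}_{d\times d}(\mathbb{R})$ is the space of real $d\times d$ matrices. *)

(* Defs.v *)
(* C^r manifolds, Riemannian metrics and the Riemannian distance are described
   in charts. Vectors of R^n are columns 'cV[R]_n; a regularity class is [Some k]
   for C^k or [None] for C^infinity. *)
From HB Require Import structures.
From mathcomp Require Import all_boot all_order all_algebra.
From mathcomp Require Import all_classical all_reals all_analysis.
Set Implicit Arguments.
Unset Strict Implicit.
Unset Printing Implicit Defensive.
Import Order.TTheory GRing.Theory Num.Theory.
Import numFieldNormedType.Exports.
Local Open Scope classical_set_scope.
Local Open Scope ring_scope.

(* [U] is meant to be open, and [E] finite dimensional: then continuity of all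
   the directional derivatives is continuity of the differential. *)
Fixpoint Ck_on (R : realType) (E F : normedModType R) (k : nat)
    (U : set E) (f : E -> F) : Prop :=
  match k with
  | 0%N => forall z, U z -> {for z, continuous f}
  | k'.+1 => (forall z, U z -> differentiable f z) /\
             (forall v : E, Ck_on k' U (fun z => 'D_v f z))
  end.

Definition Cr_on (R : realType) (E F : normedModType R) (r : option nat)
    (U : set E) (f : E -> F) : Prop :=
  if r is Some k then Ck_on k U f else forall k, Ck_on k U f.

(* Charts are total functions that are only meaningful on [dom a]; [cinv a] is
   only meaningful on the image of the chart. [chart_at] singles out one chart
   around each point. *)
Record manifold (R : realType) (n : nat) (r : option nat)
    (M : topologicalType) := Manifold {
  chart_index : Type ;
  dom : chart_index -> set M ;
  chart : chart_index -> M -> 'cV[R]_n ;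
  cinv : chart_index -> 'cV[R]_n -> M ;
  chart_at : M -> chart_index ;
  hausdorffM : hausdorff_space M ;
  second_countableM : @second_countable M ;
  dom_chart_at : forall x, dom (chart_at x) x ;
  open_dom : forall a, open (dom a) ;
  open_img : forall a, open (chart a @` dom a) ;
  chartK : forall a x, dom a x -> cinv a (chart a x) = x ;
  chart_continuous : forall a x, dom a x -> {for x, continuous (chart a)} ;
  cinv_continuous : forall a z, (chart a @` dom a) z ->
    {for z, continuous (cinv a)} ;
  transition_Cr : forall a b,
    Cr_on r [set z | (chart a @` dom a) z /\ dom b (cinv a z)]
      (chart b \o cinv a)
}.

Definition img (R : realType) (n : nat) (r : option nat)
    (M : topologicalType) (A : manifold R n r M) (a : chart_index A) :
    set 'cV[R]_n := chart a @` dom a.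

(* [U] is meant to be open. *)
Definition C1_into (R : realType) (n : nat) (r : option nat)
    (M : topologicalType) (A : manifold R n r M)
    (E : normedModType R) (U : set E) (f : E -> M) : Prop :=
  (forall z, U z -> {for z, continuous f}) /\
  (forall a : chart_index A,
     Cr_on (Some 1%N) [set z | U z /\ dom a (f z)] (chart a \o f)).

Definition C1_map (R : realType) (k n : nat) (q r : option nat)
    (N M : topologicalType) (B : manifold R k q N) (A : manifold R n r M)
    (f : N -> M) : Prop :=
  forall b : chart_index B, C1_into A (img b) (f \o cinv b).

Definition immersion (R : realType) (k n : nat) (q r : option nat)
    (N M : topologicalType) (B : manifold R k q N) (A : manifold R n r M)
    (f : N -> M) : Prop :=
  C1_map B A f /\
  (forall (y : N) (b : chart_index B) (a : chart_index A),
     dom b y -> dom a (f y) ->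
     injective ('d (chart a \o f \o cinv b) (chart b y))).

(* [S] carries a topology and a C^1 structure of dimension [k], not necessarily
   induced from [M], for which the inclusion in [M] is an immersion; this
   structure is carried by [N] and transported along the bijection [i]. *)
Definition immersed_submanifold (R : realType) (n : nat) (r : option nat)
    (M : topologicalType) (A : manifold R n r M) (k : nat) (S : set M) : Prop :=
  exists (N : topologicalType) (B : manifold R k (Some 1%N) N) (i : N -> M),
    [/\ injective i, range i = S & immersion B A i].

Definition mxform (R : realType) (n : nat) (G : 'M[R]_n) (u w : 'cV[R]_n) : R :=
  (u^T *m G *m w) 0 0.

(* [gram a z] is the Gram matrix of the metric in the coordinates of chart [a],
   at the point of coordinates [z]. *)
Record riemannian_metric (R : realType) (n : nat) (M : topologicalType)
    (A : manifold R n None M) := RiemannianMetric {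
  gram : chart_index A -> 'cV[R]_n -> 'M[R]_n ;
  gram_smooth : forall a, Cr_on None (img a) (gram a) ;
  gram_sym : forall a z, img a z -> (gram a z)^T = gram a z ;
  gram_pos : forall a z u, img a z -> u != 0 -> 0 < mxform (gram a z) u u ;
  gram_transition : forall a b x, dom a x -> dom b x ->
    forall u w : 'cV[R]_n,
      mxform (gram a (chart a x)) u w =
      mxform (gram b (chart b x))
        ('d (chart b \o cinv a) (chart a x) u)
        ('d (chart b \o cinv a) (chart a x) w)
}.

(* On each closed piece [t_i, t_(i+1)] of a subdivision 0 = t_0 < ... < t_m = 1,
   the curve agrees with one that is C^1 on the whole line. *)
Definition piecewise_C1_curve (R : realType) (n : nat) (r : option nat)
    (M : topologicalType) (A : manifold R n r M) (c : R -> M) : Prop :=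
  exists s : seq R,
    [/\ path <%R 0 s, last 0 s = 1 &
        forall i, (i < size s)%N ->
          exists e : R -> M, C1_into A [set: R] e /\
            (forall t, nth 0 (0 :: s) i <= t <= nth 0 s i -> c t = e t)].

Definition speed (R : realType) (n : nat) (M : topologicalType)
    (A : manifold R n None M) (g : riemannian_metric A) (c : R -> M) (t : R) : R :=
  let a := chart_at A (c t) in
  let w := 'D_1 (chart a \o c) t in
  Num.sqrt (mxform (gram g a (chart a (c t))) w w).

(* At the finitely many break points [speed] may be meaningless, which does not
   affect the integral. *)
Definition curve_length (R : realType) (n : nat) (M : topologicalType)
    (A : manifold R n None M) (g : riemannian_metric A) (c : R -> M) : \bar R :=
  (\int[lebesgue_measure]_(t in `[0%R, 1%R]) (speed g c t)%:E)%E.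

(* It is +oo between distinct connected components. *)
Definition riemannian_dist (R : realType) (n : nat) (M : topologicalType)
    (A : manifold R n None M) (g : riemannian_metric A) (x y : M) : \bar R :=
  ereal_inf [set l | exists c : R -> M,
    [/\ piecewise_C1_curve A c, c 0 = x, c 1 = y & l = curve_length g c]].

Definition homeomorphism (M : topologicalType) (f : M -> M) : Prop :=
  exists f' : M -> M,
    [/\ continuous f, continuous f', cancel f f' & cancel f' f].

Definition continuous_action (R : realType) (d : nat) (M : topologicalType)
    (Phi : 'cV[R]_d -> M -> M) : Prop :=
  [/\ continuous (fun p : 'cV[R]_d * M => Phi p.1 p.2),
      Phi 0 = id,
      (forall v, homeomorphism (Phi v)) &
      (forall u v, Phi (v + u) = Phi v \o Phi u)].

(* C^1 regularity of the map R^d * M -> M, in the charts id * chart. *)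
Definition C1_action (R : realType) (d n : nat) (r : option nat)
    (M : topologicalType) (A : manifold R n r M)
    (Phi : 'cV[R]_d -> M -> M) : Prop :=
  continuous_action Phi /\
  (forall a : chart_index A,
     C1_into A ([set: 'cV[R]_d] `*` img a)
       (fun p : 'cV[R]_d * 'cV[R]_n => Phi p.1 (cinv a p.2))).

Definition orbit_of (R : realType) (d : nat) (M : topologicalType)
    (Phi : 'cV[R]_d -> M -> M) (x : M) : set M :=
  [set Phi v x | v in [set: 'cV[R]_d]].

Definition separating (R : realType) (d n : nat) (M : topologicalType)
    (A : manifold R n None M) (g : riemannian_metric A)
    (Phi : 'cV[R]_d -> M -> M) : Prop :=
  exists delta : R, 0 < delta /\
    forall x y : M,
      (forall v, (riemannian_dist g (Phi v x) (Phi v y) < delta%:E)%E) ->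
      orbit_of Phi x y.

Definition homogeneous (R : realType) (d n : nat) (r : option nat)
    (M : topologicalType) (A : manifold R n r M)
    (Phi : 'cV[R]_d -> M -> M) : Prop :=
  forall x, immersed_submanifold A d (orbit_of Phi x).

Definition centralizer0 (R : realType) (d : nat) (M : topologicalType)
    (Phi : 'cV[R]_d -> M -> M) : set ('cV[R]_d -> M -> M) :=
  [set Psi | continuous_action Psi /\
             forall u v, Phi v \o Psi u = Psi u \o Phi v].

Definition quasi_trivial (R : realType) (d : nat) (M : topologicalType)
    (Phi : 'cV[R]_d -> M -> M) (Z : set ('cV[R]_d -> M -> M)) : Prop :=
  forall Psi, Z Psi ->
    exists A : M -> 'M[R]_d,
      [/\ continuous A,
          (forall v x, A x = A (Phi v x)) &
          (forall v x, Psi v x = Phi (A x *m v) x)].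

(* Main.v *)
(* Since Psi_v commutes with Phi and is uniformly close to the identity for small
   v, separation puts Psi_v x in the Phi-orbit of x. Fix x. By Baire, the times c
   with Psi_v x = Phi_c x can be chosen bounded, and then arbitrarily small, for
   v near 0.

   Homogeneity forces the stabiliser of x to contain no line: otherwise the orbit
   would be a (d-1)-dimensional Lipschitz image containing an open piece of an
   immersed d-manifold. As a closed subgroup of a finite-dimensional space with
   arbitrarily small nonzero elements contains a line, the stabiliser is discrete.
   Applied to the group of the pairs (t, c) with Psi_(tv) x = Phi_c x, the same
   fact yields alpha with Psi_(tv) x = Phi_(t alpha) x for all t; the alphas of
   the basis vectors are the columns of A(x). Discreteness makes A(x) unique,
   hence constant along orbits, and, by compactness, continuous in x. *)
Require Import Defs.
From HB Require Import structures.
From mathcomp Require Import all_boot all_order all_algebra.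
From mathcomp Require Import all_classical all_reals all_analysis.
From mathcomp Require Import ring lra.
Set Implicit Arguments.
Unset Strict Implicit.
Unset Printing Implicit Defensive.
Import Order.TTheory GRing.Theory Num.Theory.
Import numFieldNormedType.Exports.
Local Open Scope classical_set_scope.
Local Open Scope ring_scope.

(** * Finite-dimensional spaces *)

(* Completes the join [completeNormedModType], which [Baire] requires. *)
HB.instance Definition _ (R : realType) (m n : nat) := Complete.on 'M[R]_(m, n).

Lemma mx_entry_le (R : realType) (m n : nat) (B : 'M[R]_(m, n)) i j :
  `|B i j| <= `|B|.
Proof.
rewrite [leRHS]/Num.Def.normr /= mx_normrE; apply/bigmax_geP; right => /=.
by exists (i, j).
Qed.

Lemma mx_norm_le (R : realType) (m n : nat) (B : 'M[R]_(m, n)) c :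
  0 <= c -> (forall i j, `|B i j| <= c) -> `|B| <= c.
Proof.
by move=> c0 Bc; rewrite [leLHS]/Num.Def.normr /= mx_normrE bigmax_le.
Qed.

Lemma closed_norm_le (R : realType) (V : normedModType R) (r : R) :
  closed [set v : V | `|v| <= r].
Proof.
rewrite (_ : mkset _ = (fun v : V => `|v|) @^-1` [set x | x <= r]) //.
apply: preimage_closed; last exact: closed_le.
by move=> v _; apply: norm_continuous.
Qed.

Lemma trmx_continuous (R : realType) (m n : nat) :
  continuous (@trmx R m n : 'M[R]_(m, n) -> 'M[R]_(n, m)).
Proof.
move=> v B /nbhs_ballP[e /= e0 Be]; apply/nbhs_ballP; exists e => //= w.
rewrite -ball_normE /= => vw; apply: Be; rewrite -ball_normE /=.
rewrite -linearB /=; apply: le_lt_trans vw.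
by apply: mx_norm_le => // i j; rewrite mxE; apply: mx_entry_le.
Qed.

(** Transposition is continuous and preserves the sup norm, so it carries Heine-Borel from row
    vectors to columns. *)
Lemma compact_norm_le (R : realType) (d : nat) (r : R) :
  compact [set v : 'cV[R]_d | `|v| <= r].
Proof.
have -> : [set v : 'cV[R]_d | `|v| <= r] =
    (@trmx R 1 d) @` [set v : 'rV[R]_d | `|v| <= r].
  have trn (m n : nat) (w : 'M[R]_(m, n)) : `|w^T| <= `|w|.
    by apply: mx_norm_le => // i j; rewrite mxE; apply: mx_entry_le.
  apply/seteqP; split => [v vr|_ [v vr <-]] /=.
    by exists v^T; rewrite ?trmxK //=; apply: le_trans vr.
  exact: le_trans vr.
apply: continuous_compact.
  by apply: continuous_subspaceT; apply: trmx_continuous.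
apply: bounded_closed_compact; last exact: closed_norm_le.
exists r; split; [exact: num_real|].
by move=> x rx v /= vr; apply: le_trans vr (ltW rx).
Qed.

Lemma compact_norm_eq (R : realType) (V : normedModType R) (r s : R) :
  s <= r -> compact [set v : V | `|v| <= r] -> compact [set v : V | `|v| = s].
Proof.
move=> sr cV.
have -> : [set v : V | `|v| = s] =
    [set v : V | `|v| <= r] `&` (fun v : V => `|v|) @^-1` [set s].
  by apply/seteqP; split => v /=; [move=> ->|case].
apply: compact_closedI => //; apply: preimage_closed.
  by move=> v _; apply: norm_continuous.
exact: closed_eq.
Qed.

(* A small element [g] of the group has the multiple [floor (t / |g|) g] within
   [|g|] of [t g / |g|], so any limit direction [u] of small elements spans a
   line contained in the closed group. *)
Lemma closed_subgroup_line (R : realType) (V : normedModType R) (G : set V) :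
  compact [set v : V | `|v| = 1] -> closed G -> G 0 ->
  (forall u v, G u -> G v -> G (u + v)) -> (forall u, G u -> G (- u)) ->
  (forall e : R, 0 < e -> exists2 g, G g & 0 < `|g| < e) ->
  exists2 u : V, `|u| = 1 & forall t : R, G (t *: u).
Proof.
move=> cS clG G0 GD GN Gsmall; apply: contrapT => noline.
have GZ (k : int) g : G g -> G (k%:~R *: g).
  move=> Gg; have Gn (m : nat) : G (m%:R *: g).
    elim: m => [|m IH]; first by rewrite scale0r.
    by rewrite -natr1 scalerDl scale1r; apply: GD.
  case: k => m; first exact: Gn.
  by rewrite NegzE mulrNz scaleNr; apply: GN; exact: Gn.
(* [P e u]: no nonzero element of norm below [e] has direction [u]. Without lines, compactness of
   the sphere gives one [e] valid for all [u], against [Gsmall]. *)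
pose P (e : R) (u : V) := forall g, G g -> 0 < `|g| < e -> `|g|^-1 *: g <> u.
have : \forall e \near 0^'+, [set v : V | `|v| = 1] `<=` P e.
  apply: (iffLR (compact_near_coveringP _) cS) => u /= u1.
  have [t tu] : exists t : R, ~ G (t *: u).
    apply: contrapT => /forallNP H; apply: noline.
    by exists u => // t; apply: contrapT.
  have : nbhs (t *: u) (~` G).
    by apply: open_nbhs_nbhs; split => //; apply: closed_openC.
  move=> /nbhs_ballP[eta /= eta0 Beta].
  have T0 : 0 < 2 * (`|t| + 1) by rewrite mulr_gt0 // ltr_wpDl.
  (* The two halves of [eta] absorb the error in the direction and the rounding of [t / |g|] to an
     integer. *)
  exists (ball u (eta / (2 * (`|t| + 1))), [set e : R | e < eta / 2]).
    split; first by apply: nbhsx_ballx; rewrite divr_gt0.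
    by near=> e; near: e; apply: nbhs_right_lt; rewrite divr_gt0.
  move=> [v e] /= [uv /= eeta] g Gg /andP[g0 ge] gv.
  pose k := Num.floor (t / `|g|).
  apply: (Beta (k%:~R *: g)); last exact: GZ.
  rewrite -ball_normE /=.
  have -> : t *: u - k%:~R *: g = t *: (u - v) + ((t / `|g| - k%:~R) *: g).
    by rewrite scalerBl -scalerA gv scalerBr subrKA.
  apply: le_lt_trans (ler_normD _ _) _; rewrite [eta]splitr ltrD //.
    rewrite normrZ; move: uv; rewrite -ball_normE /= => uv.
    apply: (@le_lt_trans _ _ ((`|t| + 1) * `|u - v|)).
      by rewrite ler_wpM2r // lerDl.
    by rewrite -ltr_pdivlMl ?ltr_wpDl // mulrC -mulrA -invfM.
  rewrite normrZ; apply: le_lt_trans (lt_trans ge eeta).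
  rewrite ler_piMl // ger0_norm ?subr_ge0 ?floor_le //.
  by rewrite lerBlDr addrC -intrD1 ltW // floorD1_gt.
move=> nP.
have [e [Pe e0]] := @filter_ex _ (0^'+) _ _ (filterI nP (nbhs_right_gt 0)).
have [g Gg /andP[g0 ge]] := Gsmall e e0.
apply: (Pe (`|g|^-1 *: g) _ g) => //=; last by rewrite g0.
by rewrite normrZ normfV normr_id mulVf // gt_eqF.
Unshelve. all: by end_near. Qed.

(** * Baire category *)

Lemma Baire_ball (R : realType) (d : nat) (M : topologicalType)
    (W : set 'cV[R]_d) (j : 'cV[R]_d -> M) (C : nat -> set M) :
  open W -> W !=set0 -> (forall z, W z -> {for z, continuous j}) ->
  (forall k, closed (C k)) -> (forall z, W z -> exists k, C k (j z)) ->
  exists (k : nat) (z : 'cV[R]_d) (r : R),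
    [/\ 0 < r, ball z r `<=` W & forall w, ball z r w -> C k (j w)].
Proof.
move=> oW [z0 Wz0] jc clC cov; apply: contrapT => H.
have [r0 /= r00 Br0] : nbhs_ball z0 W.
  by apply/nbhs_ballP; exact: open_nbhs_nbhs.
have r20 : 0 < r0 / 2 by rewrite divr_gt0.
(* Continuity of [j] is known on [W] only; cutting the preimages to a closed ball inside [W] makes
   them closed in the whole space. *)
pose D : set 'cV[R]_d := closed_ball z0 (r0 / 2).
have DE z : D z = (`|z0 - z| <= r0 / 2) by rewrite /D closed_ballE.
have DW : D `<=` W.
  move=> z; rewrite DE => zr; apply: Br0; rewrite -ball_normE /=.
  by apply: le_lt_trans zr _; rewrite ltr_pdivrMr // ltr_pMr // ltr1n.
have clD : closed D by exact: closed_ball_closed.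
pose F k := D `&` (j @^-1` C k).
have clF k : closed (F k).
  move=> z clz; have Dz : D z.
    by apply: clD => B /clz[y [[? ?] ?]]; exists y.
  split => //; apply: (clC k) => B Bz.
  have /clz[y [[? ?] ?]] := jc z (DW z Dz) B Bz.
  by exists (j y).
have dn k : open (~` F k) /\ dense (~` F k).
  split; first exact: closed_openC.
  move=> O [z Oz] oO; apply: contrapT => /forallNP HO; apply: H.
  have OF y : O y -> F k y by move=> Oy; apply: contrapT => nF; apply: (HO y).
  have [r /= rr0 Br] : nbhs_ball z O by apply/nbhs_ballP; exact: open_nbhs_nbhs.
  exists k, z, r; split => // y /Br/OF[]; first by move=> /DW.
  by [].
have := @Baire R 'cV[R]_d _ dn (ball z0 (r0 / 2)).
case; [by exists z0; apply: ballxx; rewrite divr_gt0|exact: ball_open|].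
move=> z [z0z nz].
have Dz : D z by rewrite DE; move: z0z; rewrite -ball_normE /= => /ltW.
by have [k Ck] := cov z (DW _ Dz); apply: (nz k).
Qed.

(** * Differential estimates for C^1 maps *)

Section along_line.
Context {R : realType} {V W : normedModType R}.
Implicit Types (f : V -> W) (a w : V) (t : R).

Let growth_line f a w t :
  (fun h : R => h^-1 *: (((fun s => f (a + s *: w)) \o shift t) (h *: (1 : R))
                         - f (a + t *: w))) =
  (fun h : R => h^-1 *: ((f \o shift (a + t *: w)) (h *: w) - f (a + t *: w))).
Proof.
apply/funext => h /=; congr (_ *: (f _ - _)).
by rewrite [h *: 1]mulr1 scalerDl addrCA.
Qed.

Lemma derivable_line f a w t :
  derivable f (a + t *: w) w -> derivable (fun s : R => f (a + s *: w)) t 1.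
Proof. by rewrite /derivable growth_line. Qed.

Lemma derive_line f a w t :
  'D_1 (fun s : R => f (a + s *: w)) t = 'D_w f (a + t *: w).
Proof. by rewrite /derive growth_line. Qed.

End along_line.

Lemma col_sum_delta (R : realType) (p : nat) (w : 'cV[R]_p) :
  w = \sum_j w j 0 *: delta_mx j 0.
Proof.
by rewrite {1}[w]matrix_sum_delta; apply: eq_bigr => j _; rewrite big_ord1.
Qed.

Lemma linear_col_sum (R : realType) (p : nat) (V : lmodType R)
    (f : {linear 'cV[R]_p -> V}) (w : 'cV[R]_p) :
  f w = \sum_j w j 0 *: f (delta_mx j 0).
Proof.
rewrite {1}[w]col_sum_delta linear_sum.
by apply: eq_bigr => j _; rewrite linearZ.
Qed.

(** Stated for one entry at a time, because the intermediate [t] depends on [i]. *)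
Lemma mean_value_entry (R : realType) (p q : nat) (f : 'cV[R]_p -> 'cV[R]_q)
    (z z' : 'cV[R]_p) (i : 'I_q) :
  (forall t : R, 0 <= t <= 1 -> differentiable f (z' + t *: (z - z'))) ->
  exists2 t : R, 0 <= t <= 1 &
    (f z - f z') i 0 = ('d f (z' + t *: (z - z')) (z - z')) i 0.
Proof.
move=> df; set w := z - z'.
pose phi (t : R) := f (z' + t *: w) i 0.
have dphi (t : R) : 0 <= t <= 1 -> is_derive t 1 phi ('d f (z' + t *: w) w i 0).
  move=> t01; have dl : derivable (fun s : R => f (z' + s *: w)) t 1.
    by apply: derivable_line; apply: diff_derivable; exact: df.
  apply: DeriveDef; first exact: (derivable_mxP _ _ _).1 dl i 0.
  have := derive_mx dl; rewrite derive_line deriveE; last exact: df.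
  by move=> ->; rewrite mxE.
have [||t t01] :=
  @MVT_segment R phi (fun t => 'd f (z' + t *: w) w i 0) 0 1 ler01.
- by move=> t; rewrite in_itv /= => /andP[t0 t1]; apply: dphi; rewrite !ltW.
- apply: derivable_within_continuous => t.
  by rewrite in_itv /= => t01; have [] := dphi t t01.
rewrite /phi scale1r scale0r addr0 subr0 mulr1 /w subrKC => phiE.
by exists t; [move: t01; rewrite in_itv|rewrite !mxE phiE].
Qed.

(** Near [z0] each partial derivative is within [e / p.+1] of its value at [z0]; the mean value
    theorem on the segment from [z'] to [z] sums [p] such errors. Using [p.+1] avoids a division by
    zero when [p = 0]. *)
Lemma C1_strictly_differentiable (R : realType) (p q : nat) (U : set 'cV[R]_p)
    (f : 'cV[R]_p -> 'cV[R]_q) (z0 : 'cV[R]_p) (e : R) :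
  open U -> U z0 -> Cr_on (Some 1%N) U f -> 0 < e ->
  exists2 r : R, 0 < r & ball z0 r `<=` U /\
    forall z z', ball z0 r z -> ball z0 r z' ->
      `|f z - f z' - 'd f z0 (z - z')| <= e * `|z - z'|.
Proof.
move=> oU Uz0 [df cDf] e0.
pose e' := e / p.+1%:R.
have e'0 : 0 < e' by rewrite divr_gt0.
have cD (j : 'I_p) : \forall z \near z0,
    `|'D_(delta_mx j 0) f z0 - 'D_(delta_mx j 0) f z| < e'.
  by move/cvgrPdist_lt: (cDf (delta_mx j 0) z0 Uz0); apply.
have : \forall z \near z0, U z /\
    forall j : 'I_p, `|'D_(delta_mx j 0) f z0 - 'D_(delta_mx j 0) f z| < e'.
  apply: filterI; first exact: open_nbhs_nbhs.
  exact: (@filter_forall _ _ _ _ (nbhs_filter z0) cD).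
move=> /nbhs_ballP[r /= r0 Br]; exists r => //.
split=> [z /Br[]//|z z' Bz Bz'].
apply: mx_norm_le => [|i k]; first by rewrite mulr_ge0 // ltW.
rewrite ord1.
have Bseg (t : R) : 0 <= t <= 1 -> ball z0 r (z' + t *: (z - z')).
  move=> /andP[t0 t1]; move: Bz Bz'; rewrite -!ball_normE /= => Bz Bz'.
  have -> : z0 - (z' + t *: (z - z')) = (1 - t) *: (z0 - z') + t *: (z0 - z).
    rewrite !scalerBr !scalerBl !scale1r.
    by apply/matrixP => a b; rewrite !mxE; ring.
  apply: le_lt_trans (ler_normD _ _) _.
  rewrite !normrZ !ger0_norm ?subr_ge0 //.
  (* The strict inequality is taken from the second summand, which requires [t > 0]. *)
  have [->|tn0] := eqVneq t 0; first by rewrite subr0 mul1r mul0r addr0.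
  have tp : 0 < t by rewrite lt_def tn0.
  have -> : r = (1 - t) * r + t * r by ring.
  by rewrite ler_ltD ?ltr_pM2l // ler_wpM2l ?subr_ge0 // ltW.
have [t t01 ->] : exists2 t : R, 0 <= t <= 1 &
    (f z - f z' - 'd f z0 (z - z')) i 0 =
    ('d f (z' + t *: (z - z')) (z - z') - 'd f z0 (z - z')) i 0.
  have [t t01 ft] : exists2 t : R, 0 <= t <= 1 &
      (f z - f z') i 0 = ('d f (z' + t *: (z - z')) (z - z')) i 0.
    by apply: mean_value_entry => t /Bseg/Br[/df].
  by exists t => //; rewrite [LHS]mxE ft [RHS]mxE.
have [Uxi Hxi] := Br _ (Bseg t t01).
set xi := z' + t *: (z - z') in Uxi Hxi *; set w := z - z'.
apply: le_trans (mx_entry_le _ _ _) _.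
have -> : 'd f xi w - 'd f z0 w =
    \sum_j w j 0 *: ('D_(delta_mx j 0) f xi - 'D_(delta_mx j 0) f z0).
  rewrite [LHS](_ : _ = \sum_j w j 0 *: 'd f xi (delta_mx j 0) -
                        \sum_j w j 0 *: 'd f z0 (delta_mx j 0)).
    rewrite -sumrB; apply: eq_bigr => j _.
    by rewrite !deriveE ?scalerBr //; exact: df.
  by congr (_ - _); exact: linear_col_sum.
apply: le_trans (ler_norm_sum _ _ _) _.
apply: (@le_trans _ _ (\sum_(j < p) (`|w| * e'))).
  apply: ler_sum => j _; rewrite normrZ; apply: ler_pM => //.
    exact: mx_entry_le.
  by rewrite distrC ltW.
rewrite sumr_const card_ord -mulr_natr -mulrA mulrC ler_wpM2r //.
by rewrite /e' -mulrA ler_piMr ?(ltW e0) // ler_pdivrMl // mulr1 ler_nat.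
Qed.

(** The constant is the minimum of [|f v|] on the compact unit sphere, positive by injectivity. The
    sphere is empty when [d = 0], where any constant serves. *)
Lemma injective_linear_lower_bound (R : realType) (d : nat)
    (W : normedModType R) (f : {linear 'cV[R]_d -> W}) :
  continuous f -> injective f ->
  exists2 c : R, 0 < c & forall v, c * `|v| <= `|f v|.
Proof.
move=> cf inj_f.
pose S := [set v : 'cV[R]_d | `|v| = 1].
have cS : compact S.
  by apply: compact_norm_eq (lexx 1) _; exact: compact_norm_le.
have scaleS v : v != 0 -> S (`|v|^-1 *: v).
  by move=> v0; rewrite /S /= normrZ normfV normr_id mulVf // normr_eq0.
have [S0|/nonemptyPn nS] := pselect (S !=set0); last first.
  exists 1 => // v; have [->|/scaleS] := eqVneq v 0.
    by rewrite normr0 mulr0.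
  by rewrite nS.
have [|v Sv vmin] := @compact_EVT_min _ R (fun v => `|f v|) S S0 cS.
  apply: continuous_subspaceT => v; apply: continuous_comp; first exact: cf.
  exact: norm_continuous.
exists `|f v|.
  rewrite normr_gt0; apply/eqP => fv0.
  have v0 : v = 0 by apply: inj_f; rewrite fv0 linear0.
  by move/set_mem: Sv; rewrite /S /= v0 normr0 => /esym/eqP; rewrite oner_eq0.
move=> w; have [->|w0] := eqVneq w 0; first by rewrite normr0 mulr0.
have := vmin _ (mem_set (scaleS w w0)).
rewrite linearZ /= normrZ normfV normr_id mulrC => ?.
by rewrite -ler_pdivlMr ?normr_gt0.
Qed.

(** * Counting cells against a drop of dimension *)

Lemma truncn_eq_dist (R : realType) (x y : R) :
  0 <= x -> 0 <= y -> Num.truncn x = Num.truncn y -> `|x - y| <= 1.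
Proof.
move=> x0 y0 xy; have /andP[x1 x2] := truncn_itv x0.
have /andP[y1 y2] := truncn_itv y0.
move: x1 x2 y1 y2; rewrite xy -natr1 => *.
by rewrite ler_norml; apply/andP; split; lra.
Qed.

(* [N ^ d.+1] grid points of mutual distance of order [1 / N] would be covered by
   [O(N ^ d)] sets of diameter of that order, namely the images of the cells of
   the [d]-dimensional slice [h k0 0 = 0]. This replaces invariance of domain. *)
Lemma no_lipschitz_cover (R : realType) (d : nat) (W : normedModType R)
    (f g : 'cV[R]_d.+1 -> W) (z0 q : 'cV[R]_d.+1) (k0 : 'I_d.+1)
    (r rho c L : R) :
  0 < r -> 0 < c ->
  (forall z z', ball z0 r z -> ball z0 r z' ->
     c * `|z - z'| <= `|f z - f z'|) ->
  (forall h h', `|h - q| <= rho -> `|h' - q| <= rho ->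
     `|g h - g h'| <= L * `|h - h'|) ->
  (forall z, ball z0 r z ->
     exists h, [/\ `|h - q| <= rho, h k0 0 = 0 & f z = g h]) ->
  False.
Proof.
move=> r0 c0 fc gL cov.
wlog L0 : L gL / 0 < L.
  move=> /(_ (`|L| + 1)); apply; last by rewrite ltr_wpDl.
  move=> h h' hq h'q; apply: le_trans (gL h h' hq h'q) _.
  by rewrite ler_wpM2r // (le_trans (ler_norm _)) // lerDl.
have rho0 : 0 <= rho.
  by have [h [hq _ _]] := cov z0 (ballxx _ r0); apply: le_trans hq.
pose s := r / 2; have s0 : 0 < s by rewrite divr_gt0.
(* A side of length [2 * rho] equals [kappa * N] widths [eta], hence meets at most [K * N] cells;
   [N > K ^ d] makes the [(K * N) ^ d] cells of the slice fewer than the [N ^ d.+1] grid points. *)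
pose kappa := 4 * rho * L / (c * s).
have kappa0 : 0 <= kappa by rewrite divr_ge0 // !mulr_ge0 // ltW.
pose K := (Num.truncn kappa).+1.
have kK : kappa < K%:R by exact: truncnS_gt.
pose N := (K ^ d).+1.
have N0 : 0 < N%:R :> R by rewrite ltr0n.
(* [L * eta] is half of [c * (s / N)], the least distance between the images under [f] of two
   distinct grid points. *)
pose eta := c * s / (2 * L * N%:R).
have eta0 : 0 < eta by rewrite divr_gt0 ?mulr_gt0.
pose pt (a : {ffun 'I_d.+1 -> 'I_N}) : 'cV[R]_d.+1 :=
  z0 + \col_i (s * (a i)%:R / N%:R).
have ptB a : ball z0 r (pt a).
  rewrite -ball_normE /= /pt opprD addNKr normrN.
  apply: (@le_lt_trans _ _ s); last first.
    by rewrite /s ltr_pdivrMr // ltr_pMr // ltr1n.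
  apply: mx_norm_le => [|i j]; first exact: ltW.
  rewrite mxE ger0_norm; last first.
    by apply: divr_ge0 => //; apply: mulr_ge0 => //; exact: ltW.
  by rewrite -mulrA ler_piMr ?(ltW s0) // ler_pdivrMr // mul1r ler_nat ltnW.
have sep a b : a != b -> s / N%:R <= `|pt a - pt b|.
  move=> ab; have [i abi] : exists i, a i != b i.
    apply/existsP; rewrite -negb_forall; apply: contra ab => /forallP E.
    by apply/eqP/ffunP => i; apply/eqP.
  apply: le_trans (mx_entry_le _ i 0).
  have -> : (pt a - pt b) i 0 = s / N%:R * ((a i)%:R - (b i)%:R).
    by rewrite !mxE; ring.
  rewrite normrM [`|s / _|]ger0_norm ?divr_ge0 ?(ltW s0) ?(ltW r0) //.
  apply: ler_peMr; first by apply: divr_ge0 => //; exact: ltW.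
  have -> : (a i)%:R - (b i)%:R = ((a i)%:Z - (b i)%:Z)%:~R :> R.
    by rewrite intrB.
  rewrite -intr_norm ler1z -gtz0_ge1 normr_gt0 subr_eq0.
  by apply: contra abi => /eqP[] /val_inj ->.
have covpt a : exists h, [/\ `|h - q| <= rho, h k0 0 = 0 & f (pt a) = g h].
  exact: cov.
have [h hP] := choice covpt.
(* Position in the slice in units of [eta], shifted to be nonnegative; [lift k0] skips the
   coordinate that vanishes. *)
pose x a i := (h a (lift k0 i) 0 - q (lift k0 i) 0 + rho) / eta.
have hq a i : `|h a i 0 - q i 0| <= rho.
  have [hr _ _] := hP a; apply: le_trans hr.
  by have := mx_entry_le (h a - q) i 0; rewrite !mxE.
have x0 a i : 0 <= x a i.
  rewrite divr_ge0 ?(ltW eta0) //.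
  by have := hq a (lift k0 i); rewrite ler_norml => /andP[]; lra.
have xlt a (i : 'I_d) : (Num.truncn (x a i) < K * N)%N.
  rewrite -(ltr_nat R); apply: (@le_lt_trans _ _ (x a i)).
    by rewrite truncn_le.
  apply: (@le_lt_trans _ _ (kappa * N%:R)); last by rewrite natrM ltr_pM2r.
  rewrite ler_pdivrMr //.
  have -> : kappa * N%:R * eta = 2 * rho.
    by rewrite /kappa /eta; field; rewrite !gt_eqF.
  by have := hq a (lift k0 i); rewrite ler_norml => /andP[]; lra.
pose cell a : {ffun 'I_d -> 'I_(K * N)} := [ffun i => Ordinal (xlt a i)].
have cell_inj : injective cell.
  move=> a b cab; apply/eqP; apply: contrapT => /negP ab.
  have hab : `|h a - h b| <= eta.
    apply: mx_norm_le => [|i j]; first exact: ltW.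
    rewrite ord1 !mxE; case: (unliftP k0 i) => [i' ->|->]; last first.
      by have [_ -> _] := hP a; have [_ -> _] := hP b; rewrite subr0 normr0 ltW.
    have : `|x a i' - x b i'| <= 1.
      apply: truncn_eq_dist => //.
      by move/ffunP/(_ i'): cab; rewrite !ffunE => -[].
    have -> : x a i' - x b i' = (h a (lift k0 i') 0 - h b (lift k0 i') 0) / eta.
      by rewrite /x; field; rewrite gt_eqF.
    by rewrite normrM normfV (gtr0_norm eta0) ler_pdivrMr // mul1r.
  have [ha _ fa] := hP a; have [hb _ fb] := hP b.
  have := le_trans (fc _ _ (ptB a) (ptB b)) _; rewrite fa fb.
  move=> /(_ _ (gL _ _ ha hb)) H1.
  have : c * (s / N%:R) <= L * eta.
    apply: le_trans (ler_wpM2l (ltW c0) (sep _ _ ab)) _.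
    by apply: le_trans H1 _; rewrite ler_wpM2l // ltW.
  have -> : L * eta = c * (s / N%:R) / 2.
    by rewrite /eta; field; rewrite !gt_eqF.
  apply/negP; rewrite -ltNge ltr_pdivrMr // ltr_pMr ?ltr1n //.
  by rewrite mulr_gt0 // divr_gt0.
(* Injectivity would give [N ^ d.+1 <= K ^ d * N ^ d], that is [N <= K ^ d], whereas [N] is
   [(K ^ d).+1]. *)
have := leq_card cell cell_inj.
rewrite !card_ffun !card_ord expnMn expnS leq_pmul2r ?expn_gt0 //.
by rewrite ltnn.
Qed.
(** * Stabilisers are discrete *)

Lemma open_preimage_on (S T : topologicalType) (U : set S) (V : set T)
    (f : S -> T) :
  open U -> open V -> (forall z, U z -> {for z, continuous f}) ->
  open [set z | U z /\ V (f z)].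
Proof.
move=> oU oV cf; rewrite openE => z /= [Uz Vz].
apply: filterI; first exact: open_nbhs_nbhs.
by apply: (cf z Uz); exact: open_nbhs_nbhs.
Qed.

Lemma pair_cst_continuous (S T : topologicalType) (x : T) :
  continuous (fun h : S => (h, x)).
Proof. by move=> h; apply: cvg_pair; [exact: cvg_id|exact: cvg_cst]. Qed.

(** The derivative of the section along [v] is that of [F] along [(v, 0)]. *)
Lemma C1_section (R : realType) (V V' W : normedModType R) (U : set (V * V'))
    (F : V * V' -> W) (z : V') :
  Cr_on (Some 1%N) U F ->
  Cr_on (Some 1%N) [set h | U (h, z)] (fun h => F (h, z)).
Proof.
move=> [dF cF]; split => [h Uh|v h Uh].
  apply: (@differentiable_comp _ _ _ _ (fun h : V => (h, z)) F); last exact: dF.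
  by apply: differentiable_pair => //; exact: differentiable_cst.
have -> : (fun h' : V => 'D_v (fun h => F (h, z)) h') =
    (fun h' => 'D_(v, 0) F (h', z)).
  apply/funext => h'; rewrite /derive.
  set G := (X in lim (X @ _) = _); set G' := (X in _ = lim (X @ _)).
  suff -> : G = G' by [].
  apply/funext => t; rewrite /G /G' /=; congr (_ *: (F (_, _) - _)).
  by rewrite -[LHS]add0r -[X in X + _](scaler0 _ t).
apply: (@continuous_comp _ _ _ (fun h : V => (h, z)) (fun p => 'D_(v, 0) F p)).
  by apply: cvg_pair; [exact: cvg_id|exact: cvg_cst].
exact: (cF (v, 0) (h, z) Uh).
Qed.

Lemma orbit_map_continuous (R : realType) (d : nat) (M : topologicalType)
    (Phi : 'cV[R]_d -> M -> M) (x : M) :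
  continuous_action Phi -> continuous (Phi ^~ x).
Proof.
move=> [cPhi _ _ _] v.
apply: (@continuous_comp _ _ _ (fun h : 'cV[R]_d => (h, x))
  (fun p => Phi p.1 p.2)).
  exact: pair_cst_continuous.
exact: cPhi.
Qed.

(** Strict differentiability at [h0] with error 1, added to a Lipschitz bound [L] of the
    differential, gives the constant [1 + L]. *)
Lemma orbit_map_lipschitz (R : realType) (d n : nat) (M : topologicalType)
    (A : manifold R n None M) (Phi : 'cV[R]_d -> M -> M) (x : M)
    (h0 : 'cV[R]_d) :
  C1_action A Phi ->
  exists (a : chart_index A) (r L : R), 0 < r /\
    (forall h, `|h - h0| < r -> dom a (Phi h x)) /\
    (forall h h', `|h - h0| < r -> `|h' - h0| < r ->
       `|chart a (Phi h x) - chart a (Phi h' x)| <= L * `|h - h'|).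
Proof.
move=> [cPhi C1Phi].
pose a := chart_at A (Phi h0 x); pose b := chart_at A x.
have [_ C1a] := C1Phi b.
have {C1a} := C1_section (chart b x) (C1a a).
have cinvx : cinv b (chart b x) = x by apply: chartK; exact: dom_chart_at.
pose f h := chart a (Phi h x); pose U := [set h | dom a (Phi h x)].
have -> : (fun h => (chart a \o (fun p => Phi p.1 (cinv b p.2)))
    (h, chart b x)) = f.
  by apply/funext => h /=; rewrite cinvx.
rewrite (_ : [set h | _] = U); last first.
  apply/seteqP; split => h /=; rewrite cinvx; first by case.
  by move=> ?; split => //; split => //; exists x => //; exact: dom_chart_at.
move=> C1f.
have oU : open U.
  have := @open_preimage_on _ _ setT (dom a) (Phi ^~ x) openT (open_dom a).
  rewrite (_ : [set z | _] = U); last by apply/seteqP; split => h //= [].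
  by apply => z _; exact: orbit_map_continuous.
have Uh0 : U h0 by exact: dom_chart_at.
have [r r0 [BU fr]] := C1_strictly_differentiable oU Uh0 C1f ltr01.
have df : differentiable f h0 by have [+ _] := C1f; apply.
have [L L0 dfL] := linear_lipschitz (diff_continuous df).
have nB h : `|h - h0| < r -> ball h0 r h by rewrite -ball_normE /= distrC.
exists a, r, (1 + L); split => //; split => [h /nB/BU //|h h' /nB hr /nB h'r].
rewrite -[X in `|X|](subrK ('d f h0 (h - h'))).
apply: le_trans (ler_normD _ _) _; rewrite mulrDl lerD //.
exact: fr.
Qed.

(** The injective differential expands by at least [c]; strict differentiability with error [c / 2]
    leaves the constant [c / 2] for the map itself. *)
Lemma immersion_lower_bound (R : realType) (k n : nat) (q r : option nat)
    (N M : topologicalType) (B : manifold R k q N) (A : manifold R n r M)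
    (i : N -> M) (b : chart_index B) (a : chart_index A) (z0 : 'cV[R]_k) :
  immersion B A i -> img b z0 -> dom a (i (cinv b z0)) ->
  exists (s c : R), [/\ 0 < s, 0 < c &
    forall z z', ball z0 s z -> ball z0 s z' ->
      c * `|z - z'| <= `|chart a (i (cinv b z)) - chart a (i (cinv b z'))|].
Proof.
move=> [C1i inj_i] bz0 az0.
have [ci C1a] := C1i b.
pose U := [set z | img b z /\ dom a ((i \o cinv b) z)].
have oU : open U.
  by apply: open_preimage_on => //; [exact: open_img|exact: open_dom].
pose f := chart a \o (i \o cinv b).
have C1f : Cr_on (Some 1%N) U f := C1a a.
have Uz0 : U z0 by [].
have df : differentiable f z0 by have [+ _] := C1f; apply.
have inj_df : injective ('d f z0).
  have [y by0 yz0] := bz0.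
  have := inj_i y b a by0; rewrite yz0; apply.
  by move: az0; rewrite -yz0 chartK.
have [c c0 cdf] := injective_linear_lower_bound (diff_continuous df) inj_df.
have c20 : 0 < c / 2 by rewrite divr_gt0.
have [s s0 [_ fs]] := C1_strictly_differentiable oU Uz0 C1f c20.
exists s, (c / 2); split => // z z' zs z's.
have := fs z z' zs z's; have := cdf (z - z').
rewrite -/(f z) -/(f z').
have := ler_normD (f z - f z') ('d f z0 (z - z') - (f z - f z')).
rewrite subrKC [`|_ - (_ - _)|]distrC.
set x1 := `|f z - f z'|; set x2 := `|_ - 'd _ _ _|; set x3 := `|'d _ _ _|.
by move=> *; lra.
Qed.

(** * Absence of lines in stabilisers *)

(** Cubes with grid centres form a countable family, as the Baire argument requires. *)
Lemma int_grid_approx (R : realType) (d m : nat) (h : 'cV[R]_d) :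
  exists p : 'cV[int]_d,
    `|h - m.+1%:R^-1 *: map_mx intr p| <= m.+1%:R^-1.
Proof.
have m0 : 0 < m.+1%:R :> R by rewrite ltr0n.
exists (\col_i Num.floor (h i 0 * m.+1%:R)).
apply: mx_norm_le => [|i j]; first by rewrite invr_ge0 ltW.
rewrite ord1 !mxE.
have -> : h i 0 - m.+1%:R^-1 * (Num.floor (h i 0 * m.+1%:R))%:~R =
    m.+1%:R^-1 * (h i 0 * m.+1%:R - (Num.floor (h i 0 * m.+1%:R))%:~R).
  by field; rewrite gt_eqF.
rewrite ger0_norm; last first.
  by rewrite mulr_ge0 ?invr_ge0 ?(ltW m0) // subr_ge0 floor_le.
rewrite ler_piMr ?invr_ge0 ?(ltW m0) //.
by rewrite lerBlDr addrC -intrD1 ltW // floorD1_gt.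
Qed.

Lemma compact_slice (R : realType) (d : nat) (q : 'cV[R]_d) (rho : R)
    (k0 : 'I_d) :
  compact [set h : 'cV[R]_d | `|h - q| <= rho /\ h k0 0 = 0].
Proof.
have -> : [set h : 'cV[R]_d | `|h - q| <= rho /\ h k0 0 = 0] =
   [set h : 'cV[R]_d | `|h| <= `|q| + rho] `&`
   ((fun h : 'cV[R]_d => h - q) @^-1` [set h | `|h| <= rho] `&`
    (fun h : 'cV[R]_d => h k0 0) @^-1` [set 0]).
  apply/seteqP; split => h /=; last by move=> [_ []].
  move=> [hq h0]; split => //; rewrite -[h](subrK q) addrC.
  by apply: le_trans (ler_normD _ _) _; rewrite lerD2l.
apply: compact_closedI; first exact: compact_norm_le.
apply: closedI.
  apply: preimage_closed; last exact: closed_norm_le.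
  by move=> h _; apply: continuousB => //; exact: cst_continuous.
apply: preimage_closed; last exact: closed_eq.
by move=> h _; exact: coord_continuous.
Qed.

(* If the line of [u] fixed [x], the orbit would be the image of the hyperplane
   [h k0 0 = 0], hence a countable union of Lipschitz images of compact pieces of it. By Baire
   one of them contains an open piece of the [d]-dimensional immersed orbit,
   which [no_lipschitz_cover] forbids. *)
Lemma stabilizer_no_line (R : realType) (d n : nat) (M : topologicalType)
    (A : manifold R n None M) (Phi : 'cV[R]_d -> M -> M) (x : M)
    (u : 'cV[R]_d) :
  C1_action A Phi -> immersed_submanifold A d (orbit_of Phi x) ->
  (forall t : R, Phi (t *: u) x = x) -> u = 0.
Proof.
case: d Phi u => [|d] Phi u C1Phi; first by rewrite [u]flatmx0.
move=> [N [B [i [_ ri imm]]]] ux.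
apply/eqP; apply: contrapT => /negP u0.
have [k0 uk0] : exists k0, u k0 0 != 0.
  by have /matrix0Pn[k0 [j]] := u0; rewrite ord1 => ?; exists k0.
have [cPhi _] := C1Phi; have [_ Phi0 _ PhiD] := cPhi.
have [y _ yx] : range i x by rewrite ri; exists 0 => //; rewrite Phi0.
pose b := chart_at B y.
have [C1i _] := imm; have [ci _] := C1i b.
pose rad m : R := m.+1%:R^-1.
have rad0 m : 0 < rad m by rewrite invr_gt0 ltr0n.
pose ctr (p : 'cV[int]_d.+1) m : 'cV[R]_d.+1 := rad m *: map_mx intr p.
pose good p m (a : chart_index A) (L : R) :=
  (forall h, `|h - ctr p m| <= rad m -> dom a (Phi h x)) /\
  (forall h h', `|h - ctr p m| <= rad m -> `|h' - ctr p m| <= rad m ->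
     `|chart a (Phi h x) - chart a (Phi h' x)| <= L * `|h - h'|).
pose slice p m := [set h : 'cV[R]_d.+1 | `|h - ctr p m| <= rad m /\ h k0 0 = 0].
(* The pairs of a grid centre and a mesh are enumerated by [unpickle]; codes of no pair and cubes
   that are not [good] contribute the empty set. *)
pose C k := if unpickle k is Some pm then
    [set z | (exists a L, good pm.1 pm.2 a L) /\
             (Phi ^~ x @` slice pm.1 pm.2) z] else set0.
have clC k : closed (C k).
  rewrite /C; case: unpickle => [[p m]/=|]; last exact: closed0.
  have [g|ng] := pselect (exists a L, good p m a L); last first.
    rewrite (_ : mkset _ = set0); first exact: closed0.
    by apply/seteqP; split => z [].
  rewrite (_ : mkset _ = Phi ^~ x @` slice p m); last first.
    by apply/seteqP; split => z //= [].
  apply: compact_closed; first exact: hausdorffM A.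
  apply: continuous_compact; last exact: compact_slice.
  by apply: continuous_subspaceT; exact: orbit_map_continuous.
have cov z : img b z -> exists k, C k ((i \o cinv b) z).
  move=> bz; have [v _ vz] : orbit_of Phi x (i (cinv b z)).
    by rewrite -ri; exists (cinv b z).
  (* Moving along the line of [u], which fixes [x], cancels the coordinate [k0] without changing the
     point of the orbit. *)
  pose h := v - (v k0 0 / u k0 0) *: u.
  have hx : Phi h x = i (cinv b z) by rewrite -vz /h -scaleNr PhiD /= ux.
  have hk0 : h k0 0 = 0 by rewrite !mxE divfK // subrr.
  have [a [r [L [r0 [ar Lr]]]]] := orbit_map_lipschitz x h C1Phi.
  have [m mr] : exists m, rad m < r / 2.
    have r20 : 0 < r / 2 by rewrite divr_gt0.
    exists (Num.truncn (r / 2)^-1).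
    by rewrite /rad -[ltRHS]invrK ltf_pV2 ?posrE ?ltr0n ?invr_gt0 // truncnS_gt.
  have [p hp] := int_grid_approx m h; rewrite -/(rad m) -/(ctr p m) in hp.
  have near_h h' : `|h' - ctr p m| <= rad m -> `|h' - h| < r.
    move=> h'p; apply: le_lt_trans (ler_distD (ctr p m) _ _) _.
    rewrite [r]splitr [`|ctr p m - h|]distrC ltr_leD //.
      exact: le_lt_trans mr.
    exact: le_trans hp (ltW mr).
  exists (pickle (p, m)); rewrite /C pickleK /=; split; last first.
    by exists h.
  exists a, L; split => [h' /near_h/ar//|h' h'' /near_h h'r /near_h h''r].
  exact: Lr.
have by0 : dom b y by exact: dom_chart_at.
have Wy : img b !=set0 by exists (chart b y); exists y.
have [k [z [r [r0 rW rC]]]] := Baire_ball (@open_img _ _ _ _ B b) Wy ci clC cov.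
have zz : ball z r z by exact: ballxx.
move: rC; rewrite /C; case: unpickle => [[p m]/=|]; last by move=> /(_ z zz).
move=> rC; have [[a [L [gdom gL]]] _] := rC z zz.
have az : dom a (i (cinv b z)).
  by have [_ [h [hp _] <-]] := rC z zz; exact: gdom.
have [s [c [s0 c0 sc]]] := immersion_lower_bound imm (rW z zz) az.
(* The covering by the slice holds on the ball of radius [r], the lower bound for the immersion on
   that of radius [s]. *)
have rs0 : 0 < Num.min r s by rewrite lt_min r0.
have minB w : ball z (Num.min r s) w -> ball z r w /\ ball z s w.
  by rewrite -!ball_normE /= lt_min => /andP[].
refine (@no_lipschitz_cover R d 'cV[R]_n (fun z => chart a (i (cinv b z)))
  (fun h => chart a (Phi h x)) z (ctr p m) k0 (Num.min r s) (rad m) c L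
  rs0 c0 _ gL _).
  by move=> w w' /minB[_ ws] /minB[_ w's]; exact: sc.
by move=> w /minB[/rC[_ [h [hp h0] hw]] _]; exists h; rewrite hw.
Qed.
(** * The Riemannian distance is locally small *)

Lemma cvg_near_eq (S T : topologicalType) (f g : S -> T) (x : S) :
  (\forall y \near x, f y = g y :> T) ->
  {for x, continuous f} -> {for x, continuous g}.
Proof.
move=> fg cf V; rewrite -(nbhs_singleton fg) => /cf.
by apply: filterS2 fg => t /= ->.
Qed.

Section reparametrized_segment.
Context {R : realType} {V W : normedModType R}.
Variables (U : set V) (tau : V -> W) (z w : V) (s s' : R -> R).
Hypothesis ds : forall t : R, is_derive t (1 : R) s (s' t).

Let gamma t := z + s t *: w.

Lemma segment_continuous : continuous gamma.
Proof.
move=> t; apply: cvgD; first exact: cvg_cst.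
apply: cvgZr_tmp; apply: differentiable_continuous; apply/derivable1_diffP.
by have [] := ds t.
Qed.

Lemma diff_segment t : differentiable gamma t /\
  forall v, 'd gamma t v = (v * s' t) *: w.
Proof.
have dst : differentiable s t by apply/derivable1_diffP; have [] := ds t.
have dsw : differentiable (fun t => s t *: w) t by exact: differentiableZl.
have dg : differentiable gamma t.
  exact: (@differentiableD _ _ _ (cst z) (fun t => s t *: w)).
split=> // v.
rewrite (_ : gamma = cst z + (fun t => s t *: w)) // diffD //.
rewrite diff_cst diffZl // /= add0r diff1E //; congr (_ *: _).
by rewrite derive1E; have [_ ->] := ds t.
Qed.

Hypotheses (C1tau : Cr_on (Some 1%N) U tau).

Lemma derive_segment_comp t v : U (gamma t) ->
  differentiable (tau \o gamma) t /\
  'D_v (tau \o gamma) t = (v * s' t) *: 'd tau (gamma t) w.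
Proof.
move=> Ut; have [dtau _] := C1tau; have [dg dgE] := diff_segment t.
have dc : differentiable (tau \o gamma) t.
  by apply: differentiable_comp => //; exact: dtau.
split=> //; rewrite deriveE // diff_comp //; last exact: dtau.
by rewrite /= dgE linearZ.
Qed.

Lemma C1_segment_comp : open U -> continuous s' ->
  Cr_on (Some 1%N) [set t | U (gamma t)] (tau \o gamma).
Proof.
move=> oU cs'; split => [t Ut|v t Ut].
  by have [] := derive_segment_comp 0 Ut.
have [dtau cD] := C1tau.
apply: (@cvg_near_eq _ _ (fun t => (v * s' t) *: 'D_w tau (gamma t))).
  have : \forall t' \near t, U (gamma t').
    by apply: segment_continuous; exact: open_nbhs_nbhs.
  apply: filterS => t' Ut'; have [_ ->] := derive_segment_comp v Ut'.
  by rewrite deriveE //; exact: dtau.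
apply: cvgZ; first by apply: cvgM; [exact: cvg_cst|exact: cs'].
apply: (@continuous_comp _ _ _ gamma (fun p => 'D_w tau p)).
  exact: segment_continuous.
exact: cD.
Qed.

End reparametrized_segment.

(** Measurability of [f] is not assumed: the integral is a supremum over simple functions below [f],
    and these lie below [k]. This suits [speed], whose chart varies with the point. *)
Lemma ge0_integral_le_cst (d : measure_display) (T : measurableType d)
    (R : realType) (mu : {measure set T -> \bar R}) (D : set T)
    (f : T -> \bar R) (k : \bar R) :
  (forall x, D x -> (0 <= f x <= k)%E) ->
  (\int[mu]_(x in D) f x <= \int[mu]_(x in D) (cst k x))%E.
Proof.
move=> fk; rewrite !ge0_integralE.
- apply: ereal_sup_le => _ [h hf <-]; exists h => //= x.
  apply: le_trans (hf x) _; rewrite /patch; case: ifP => //.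
  by rewrite inE => /fk/andP[].
- by move=> x /fk /andP[]; exact: le_trans.
- by move=> x /fk /andP[].
Qed.

Lemma mxform_le (R : realType) (n : nat) (G : 'M[R]_n) (u : 'cV[R]_n) :
  mxform G u u <= n%:R ^+ 2 * `|G| * `|u| ^+ 2.
Proof.
rewrite /mxform mxE.
have -> : n%:R ^+ 2 * `|G| * `|u| ^+ 2 =
    \sum_(j < n) (n%:R * (`|G| * `|u| ^+ 2)).
  by rewrite sumr_const card_ord -mulr_natl; ring.
apply: ler_sum => j _; rewrite mxE mulr_suml.
have -> : n%:R * (`|G| * `|u| ^+ 2) = \sum_(i < n) (`|G| * `|u| ^+ 2).
  by rewrite sumr_const card_ord mulr_natl.
apply: ler_sum => i _; rewrite mxE.
apply: le_trans (ler_norm _) _; rewrite !normrM.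
rewrite expr2 [leRHS]mulrCA mulrA.
by apply: ler_pM; rewrite ?mx_entry_le //; apply: ler_pM; rewrite ?mx_entry_le.
Qed.

(** Near [p] the Gram matrix of one chart is bounded, so a coordinate segment between two nearby
    points is a short curve, and it bounds the infimum. *)
Lemma riemannian_dist_locally_small (R : realType) (n : nat)
    (M : topologicalType) (A : manifold R n None M) (g : riemannian_metric A)
    (p : M) (delta : R) :
  0 < delta ->
  exists2 U : set M, nbhs p U &
    forall x y, U x -> U y -> (riemannian_dist g x y < delta%:E)%E.
Proof.
move=> delta0; pose a := chart_at A p; pose z0 := chart a p.
have ap : dom a p by exact: dom_chart_at.
have az0 : img a z0 by exists p.
have imgK z : img a z -> chart a (cinv a z) = z /\ dom a (cinv a z).
  by move=> [x ax <-]; rewrite chartK.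
(* The 4 is the square of the bound 2 on [|s'|]. The final 1 gives [Q <= Q ^+ 2], so [Q] also bounds
   the speed after the square root. *)
pose Q := n%:R ^+ 2 * (`|gram g a z0| + 1) * 4 + 1.
have Q0 : 1 <= Q by rewrite lerDr !mulr_ge0 ?exprn_ge0 ?addr_ge0.
have [r r0 [r_img r_gram]] : exists2 r : R, 0 < r &
    (ball z0 r `<=` img a) /\
    (forall z, ball z0 r z -> `|gram g a z| <= `|gram g a z0| + 1).
  have cg : {for z0, continuous (gram g a)} := gram_smooth g a 0%N z0 az0.
  have : \forall z \near z0, img a z /\ `|gram g a z| <= `|gram g a z0| + 1.
    apply: filterI.
      by apply: open_nbhs_nbhs; split => //; exact: open_img.
    have : \forall z \near z0, `|gram g a z0 - gram g a z| < 1.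
      by move/cvgrPdist_lt: cg; apply.
    apply: filterS => z zz; rewrite -lerBlDl ltW //.
    by apply: le_lt_trans zz; rewrite distrC; apply: le_trans (lerB_dist _ _) _.
  move=> /nbhs_ballP[r /= r0 Br]; exists r => //.
  by split => z /Br[].
(* The curve stays within [e + 2 * e] of [z0], and its length is below [2 * e * Q]. *)
pose e := Num.min (r / 3) (delta / (2 * Q)).
have Qp : 0 < Q by exact: lt_le_trans Q0.
have e0 : 0 < e by rewrite lt_min !divr_gt0 // mulr_gt0.
have er : 3 * e <= r by rewrite mulrC -ler_pdivlMr // ge_min lexx.
have eQ : 2 * e * Q <= delta.
  have : e <= delta / (2 * Q) by rewrite ge_min lexx orbT.
  by rewrite ler_pdivlMr ?mulr_gt0 // mulrA [e * 2]mulrC.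
exists (dom a `&` chart a @^-1` ball z0 e).
  apply: filterI; first by apply: open_nbhs_nbhs; split => //; exact: open_dom.
  by apply: (chart_continuous ap); exact: nbhsx_ballx.
move=> x y [ax xe] [ay ye]; pose z := chart a x; pose w := chart a y - z.
have w2 : `|w| < 2 * e.
  rewrite /w /z; apply: le_lt_trans (ler_distD z0 _ _) _.
  move: xe ye; rewrite -!ball_normE /= => xe ye.
  by rewrite [`|_ - z0|]distrC mulr_natl mulr2n ltrD.
(* The sine keeps the segment inside the chart for all times, as
   [piecewise_C1_curve] asks for a curve that is C^1 on the whole line. *)
pose s (t : R) := sin (t * (pi / 2)).
pose s' (t : R) := cos (t * (pi / 2)) * (pi / 2).
have ds (t : R) : is_derive t (1 : R) s (s' t).
  apply: (@is_derive1_comp _ sin (fun t => t * (pi / 2))).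
  by apply: is_derive_eq; rewrite scaler0 add0r [_ *: 1]mulr1.
have cs' : continuous s'.
  move=> t; apply: cvgM; last exact: cvg_cst.
  apply: (@continuous_comp _ _ _ (fun t : R => t * (pi / 2)) cos).
    by apply: cvgM; [exact: cvg_id|exact: cvg_cst].
  exact: continuous_cos.
have s'2 t : `|s' t| <= 2.
  rewrite normrM -[leRHS]mul1r ler_pM //.
    by rewrite ler_norml cos_geN1 cos_le1.
  by rewrite ger0_norm ?divr_ge0 ?pi_ge0 // ltW // pihalf_lt2.
pose gam t := z + s t *: w.
have gamr t : ball z0 r (gam t).
  rewrite -ball_normE /= /gam opprD addrA.
  apply: le_lt_trans (ler_normB _ _) _; apply: lt_le_trans er.
  rewrite (_ : 3 * e = e + 2 * e); last by ring.
  apply: ltrD; first by move: xe; rewrite -ball_normE.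
  apply: le_lt_trans w2; rewrite normrZ ler_piMl //.
  by rewrite ler_norml sin_geN1 sin_le1.
have gam_img t : img a (gam t) by exact/r_img/gamr.
pose c t := cinv a (gam t).
have c0 : c 0 = x by rewrite /c /gam /s mul0r sin0 scale0r addr0 chartK.
have c1 : c 1 = y.
  by rewrite /c /gam /s mul1r sin_pihalf scale1r /w subrKC chartK.
have cgam : continuous gam by exact: (@segment_continuous R _ z w s s' ds).
pose Ub (b : chart_index A) := [set z | img a z /\ dom b (cinv a z)].
have oUb (b : chart_index A) : open (Ub b).
  apply: open_preimage_on; [exact: open_img|exact: open_dom|].
  exact: cinv_continuous.
have C1tau (b : chart_index A) : Cr_on (Some 1%N) (Ub b) (chart b \o cinv a).
  exact: (transition_Cr a b 1%N).
have C1c : C1_into A [set: R] c.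
  split=> [t _|b].
    apply: (@continuous_comp _ _ _ gam (cinv a)); first exact: cgam.
    exact: (cinv_continuous (gam_img t)).
  have := C1_segment_comp z w ds (C1tau b) (oUb b) cs'.
  rewrite (_ : [set t | _] = [set t | setT t /\ dom b (c t)]) //.
  apply/seteqP; split => t /= [_ ?]; split => //.
  exact: gam_img.
have speed_le t : speed g c t <= Q * `|w|.
  pose b := chart_at A (c t); pose v := 'D_1 (chart b \o c) t.
  have -> : speed g c t = Num.sqrt (mxform (gram g b (chart b (c t))) v v).
    by [].
  have bt : dom b (c t) by exact: dom_chart_at.
  have [gK at_] := imgK _ (gam_img t).
  (* [speed] is measured in the chart [b] selected at [c t]; this expression lets [gram_transition]
     return to the fixed chart [a]. *)
  have vE : v = 'd (chart b \o cinv a) (chart a (c t)) (s' t *: w).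
    have [_] := @derive_segment_comp R _ _ (Ub b) _ z w s s' ds (C1tau b) t 1
      (conj (gam_img t) bt).
    rewrite mul1r -/(gam t) => vE.
    by rewrite /c gK linearZ; exact: vE.
  rewrite vE -(gram_transition g at_ bt).
  rewrite -[Q * _]ger0_norm ?mulr_ge0 ?(ltW Qp) //.
  rewrite -sqrtr_sqr ler_sqrt ?sqr_ge0 //.
  apply: le_trans (mxform_le _ _) _; rewrite /c gK normrZ !exprMn.
  rewrite mulrA ler_wpM2r ?sqr_ge0 //.
  apply: (@le_trans _ _ Q); last by rewrite expr2 ler_peMr // ltW.
  rewrite /Q; apply: ler_wpDr => //.
  apply: ler_pM => //; rewrite ?mulr_ge0 ?exprn_ge0 //.
    by rewrite ler_wpM2l ?exprn_ge0 //; exact: r_gram.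
  have := s'2 t; have := normr_ge0 (s' t); nra.
have len_lt : (curve_length g c < delta%:E)%E.
  apply: (@le_lt_trans _ _ (Q * `|w|)%:E).
    apply: le_trans (@ge0_integral_le_cst _ _ _ _ _ _ (Q * `|w|)%:E _) _.
      by move=> t _; rewrite !lee_fin speed_le sqrtr_ge0.
    rewrite integral_cst //= lebesgue_measure_itv /= lte_fin ltr01.
    by rewrite -EFinD subr0 mule1.
  rewrite lte_fin; apply: lt_le_trans eQ.
  by rewrite mulrC ltr_pM2r.
apply: le_lt_trans len_lt; apply: ereal_inf_lbound.
exists c; split=> //; exists [:: 1]; split; rewrite /= ?ltr01 //.
by move=> [|//] _; exists c.
Qed.

(** * Commuting actions *)

Lemma near_neq (S T : topologicalType) (f g : S -> T) (s : S) :
  hausdorff_space T -> {for s, continuous f} -> {for s, continuous g} ->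
  f s <> g s -> \forall t \near s, f t <> g t.
Proof.
rewrite open_hausdorff => hT cf cg /eqP/hT[[B C] /= [/set_mem Bf /set_mem Cg]].
move=> [oB oC /eqP BC].
have nB : \forall t \near s, B (f t) by apply: cf; exact: open_nbhs_nbhs.
have nC : \forall t \near s, C (g t) by apply: cg; exact: open_nbhs_nbhs.
apply: filterS2 nB nC => t Bt Ct ft.
have : (B `&` C) (f t) by split; rewrite // ft.
by rewrite BC.
Qed.

Lemma closed_eq_fun (S T : topologicalType) (f g : S -> T) :
  hausdorff_space T -> continuous f -> continuous g ->
  closed [set s | f s = g s].
Proof.
move=> hT cf cg; rewrite (_ : mkset _ = ~` [set s | f s <> g s]); last first.
  by apply/seteqP; split => s /=; [move=> ->|move/contrapT].
apply: open_closedC; rewrite openE => s /= fg.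
exact: near_neq hT (cf s) (cg s) fg.
Qed.

Lemma mulmx_continuous (R : realType) (m p q : nat) (B : 'M[R]_(m, p)) :
  continuous (fun w : 'M[R]_(p, q) => B *m w).
Proof.
have Bw (w : 'M[R]_(p, q)) : `|B *m w| <= p%:R * `|B| * `|w|.
  apply: mx_norm_le => [|i j]; first by rewrite !mulr_ge0.
  rewrite mxE; apply: le_trans (ler_norm_sum _ _ _) _.
  apply: (@le_trans _ _ (\sum_(k < p) (`|B| * `|w|))).
    by apply: ler_sum => k _; rewrite normrM ler_pM ?mx_entry_le.
  by rewrite sumr_const card_ord mulr_natl mulrnAl.
move=> w V /nbhs_ballP[e /= e0 Ve]; apply/nbhs_ballP.
have K0 : 0 < p%:R * `|B| + 1 by rewrite ltr_wpDl // mulr_ge0.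
exists (e / (p%:R * `|B| + 1)); first by rewrite /= divr_gt0.
move=> w'; rewrite -ball_normE /= => ww'; apply: Ve; rewrite -ball_normE /=.
rewrite -mulmxBr; apply: le_lt_trans (Bw _) _.
apply: (@le_lt_trans _ _ ((p%:R * `|B| + 1) * `|w - w'|)).
  by rewrite ler_wpM2r // lerDl.
by rewrite -ltr_pdivlMl // mulrC.
Qed.

Lemma cvg_continuous2 (T : Type) (S S' W : topologicalType) (F : set_system T)
    (h : S * S' -> W) (f : T -> S) (g : T -> S') (a : S) (b : S') :
  Filter F -> continuous h -> f @ F --> a -> g @ F --> b ->
  (fun t => h (f t, g t)) @ F --> h (a, b).
Proof.
move=> FF ch fa gb.
by apply: (cvg_comp (fun t => (f t, g t)) h) (ch (a, b)); exact: cvg_pair.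
Qed.

(** * Stabilisers as closed subgroups *)

Section action.
Context {R : realType} {d : nat} {M : topologicalType}.
Variable Phi : 'cV[R]_d -> M -> M.
Hypothesis actPhi : continuous_action Phi.

Lemma act0 x : Phi 0 x = x.
Proof. by have [_ -> _ _] := actPhi. Qed.

Lemma actD v u x : Phi (v + u) x = Phi v (Phi u x).
Proof. by have [_ _ _ ->] := actPhi. Qed.

Lemma actNK v x : Phi (- v) (Phi v x) = x.
Proof. by rewrite -actD addNr act0. Qed.

Lemma act_cvg (T : Type) (F : set_system T) (v : T -> 'cV[R]_d) (y : T -> M)
    (v0 : 'cV[R]_d) (y0 : M) :
  Filter F -> v @ F --> v0 -> y @ F --> y0 ->
  (fun t => Phi (v t) (y t)) @ F --> Phi v0 y0.
Proof.
move=> FF cv cy; have [cPhi _ _ _] := actPhi.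
exact: (cvg_continuous2 FF cPhi cv cy).
Qed.

Lemma stabilizer_subgroup x :
  hausdorff_space M ->
  [/\ closed [set c | Phi c x = x], Phi 0 x = x,
      (forall u v, Phi u x = x -> Phi v x = x -> Phi (u + v) x = x) &
      (forall u, Phi u x = x -> Phi (- u) x = x)].
Proof.
move=> hM; split; last 3 first.
- exact: act0.
- by move=> u v ux vx; rewrite actD vx.
- by move=> u ux; rewrite -[in LHS]ux actNK.
apply: closed_eq_fun => //; first exact: orbit_map_continuous.
exact: cst_continuous.
Qed.

Lemma stabilizer_discrete x : hausdorff_space M ->
  (forall u, (forall t : R, Phi (t *: u) x = x) -> u = 0) ->
  exists2 r : R, 0 < r & forall c, Phi c x = x -> `|c| < r -> c = 0.
Proof.
move=> hM noline; apply: contrapT => H.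
have [cl G0 GD GN] := stabilizer_subgroup x hM.
have cS : compact [set v : 'cV[R]_d | `|v| = 1].
  by apply: compact_norm_eq (lexx 1) _; exact: compact_norm_le.
have [|u u1 /noline u0] := closed_subgroup_line cS cl G0 GD GN.
  move=> e e0; apply: contrapT => He; apply: H; exists e => // c cx ce.
  apply/eqP; apply: contrapT => /negP c0; apply: He; exists c => //.
  by rewrite normr_gt0 c0.
by move: u1; rewrite u0 normr0 => /esym/eqP; rewrite oner_eq0.
Qed.

End action.

(** * Exponents of a commuting action *)

Section centralizer.
Context {R : realType} {d : nat} {M : topologicalType}.
Variables Phi Psi : 'cV[R]_d -> M -> M.
Hypothesis hM : hausdorff_space M.
Hypotheses (actPhi : continuous_action Phi) (actPsi : continuous_action Psi).
Hypothesis comm : forall u v x, Phi v (Psi u x) = Psi u (Phi v x).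

Section point.
Variable x : M.
Hypothesis orb : forall v, orbit_of Phi x (Psi v x).
Hypothesis noline : forall u, (forall t : R, Phi (t *: u) x = x) -> u = 0.

(** Baire bounds the times by some [k] on a ball around some [z]; comparing [z] with [v + z] moves
    the bound to the origin, where it doubles. *)
Lemma bounded_times : exists (r K : R), 0 < r /\
  forall v, `|v| < r -> exists2 c, `|c| <= K & Psi v x = Phi c x.
Proof.
pose C (k : nat) := Phi ^~ x @` [set h | `|h| <= k%:R].
have clC k : closed (C k).
  apply: compact_closed => //.
  apply: continuous_compact; last exact: compact_norm_le.
  by apply: continuous_subspaceT; exact: orbit_map_continuous.
have cov z : [set: 'cV[R]_d] z -> exists k, C k (Psi z x).
  move=> _; have [c _ cz] := orb z; exists (Num.truncn `|c|).+1.
  by exists c => //=; rewrite ltW // truncnS_gt.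
have cPsi : continuous (Psi ^~ x) by exact: orbit_map_continuous.
have [k [z [r [r0 _ rC]]]] := Baire_ball openT (ex_intro _ 0 I)
  (fun z _ => cPsi z) clC cov.
exists r, (k%:R + k%:R); split => // v vr.
have [a ak az] := rC z (ballxx _ r0).
have [b bk bz] : C k (Psi (v + z) x).
  by apply: rC; rewrite -ball_normE /= opprD addrCA subrr addr0 normrN.
exists (- a + b); first by rewrite (le_trans (ler_normD _ _)) // normrN lerD.
by rewrite (actD actPhi) bz (actD actPsi) -az -comm (actNK actPhi).
Qed.

(** As [v] tends to 0, bounded times accumulate only at stabilisers of [x]. Subtracting from [c] a
    stabiliser [g] within [e] of it leaves a small time. *)
Lemma small_times (e : R) : 0 < e -> exists2 r : R, 0 < r &
  forall v, `|v| < r -> exists2 c, `|c| < e & Psi v x = Phi c x.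
Proof.
move=> e0; have [r [K [r0 rK]]] := bounded_times.
have : \forall v \near (0 : 'cV[R]_d), [set c : 'cV[R]_d | `|c| <= K] `<=`
    (fun c => Psi v x = Phi c x -> exists2 g, Phi g x = x & `|g - c| < e).
  apply: ((compact_near_coveringP _).1 (@compact_norm_le R d K) _
    (nbhs (0 : 'cV[R]_d)) (fun v c => Psi v x = Phi c x ->
      exists2 g, Phi g x = x & `|g - c| < e) (nbhs_filter _)) => c _.
  (* Either [c] itself serves as [g] for all nearby times, or [Phi c x] differs from [Psi 0 x],
     which persists nearby. *)
  have [cx|cx] := pselect (Phi c x = x).
    exists (ball c e, setT) => [|[c' v] /= [cc' _] _].
      by split; [exact: nbhsx_ballx|exact: filterT].
    by exists c => //; move: cc'; rewrite -ball_normE.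
  have : \forall p \near (c, (0 : 'cV[R]_d)), Phi p.1 x <> Psi p.2 x.
    apply: (@near_neq _ _ (fun p : 'cV[R]_d * 'cV[R]_d => Phi p.1 x)
                          (fun p => Psi p.2 x)) => //=.
    - by apply: (act_cvg actPhi); [exact: cvg_fst|exact: cvg_cst].
    - by apply: (act_cvg actPsi); [exact: cvg_snd|exact: cvg_cst].
    - by rewrite (act0 actPsi).
  by apply: filterS => -[c' v] /= ne E; case: ne.
move=> /nbhs_ballP[s /= s0 Bs].
exists (Num.min r s) => [|v]; first by rewrite lt_min r0.
rewrite lt_min => /andP[/rK[c cK vc] vs].
have [g gx gc] : exists2 g, Phi g x = x & `|g - c| < e.
  by apply: (Bs v _ c cK vc); rewrite -ball_normE /= sub0r normrN.
exists (c - g); first by rewrite distrC.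
rewrite (actD actPhi) vc; congr (Phi c).
by rewrite -[in LHS](actNK actPhi g x) gx.
Qed.

(* The line lemma is applied to the closed group of pairs [(t, c)] such that
   [Psi (t v) x = Phi c x]; the line is not vertical as stabilisers contain
   no line. *)
Lemma one_parameter_exponent (v : 'cV[R]_d) :
  exists alpha, forall t : R, Psi (t *: v) x = Phi (t *: alpha) x.
Proof.
pose V := (R * 'cV[R]_d)%type.
pose G : set V := [set p | Psi (p.1 *: v) x = Phi p.2 x].
have cS : compact [set p : V | `|p| = 1].
  apply: compact_norm_eq (lexx 1) _.
  rewrite (_ : mkset _ =
    [set t : R | `|t| <= 1] `*` [set c : 'cV[R]_d | `|c| <= 1]).
    apply: compact_setX; last exact: compact_norm_le.
    rewrite (_ : mkset _ = [set` `[-1, 1]]); first exact: segment_compact.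
    by apply/seteqP; split => t; rewrite /= in_itv /= ler_norml.
  by apply/seteqP; split => -[t c] /=; rewrite prod_normE /= ge_max => /andP.
have clG : closed G.
  apply: closed_eq_fun => // p.
    apply: (act_cvg actPsi); last exact: cvg_cst.
    by apply: cvgZr_tmp; exact: cvg_fst.
  by apply: (act_cvg actPhi); [exact: cvg_snd|exact: cvg_cst].
have G0 : G 0.
  by rewrite /G /= scale0r (act0 actPhi) (act0 actPsi).
have GD p q : G p -> G q -> G (p + q).
  case: p q => [t c] [t' c']; rewrite /G /= => tc tc'.
  by rewrite scalerDl (actD actPsi) tc' -comm tc -(actD actPhi) addrC.
have GN p : G p -> G (- p).
  case: p => [t c]; rewrite /G /= => tc.
  rewrite scaleNr -[LHS](actNK actPhi c) comm -tc.
  by rewrite (actNK actPsi).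
have Gsmall (e : R) : 0 < e -> exists2 p, G p & 0 < `|p| < e.
  move=> e0; have [r r0 small] := small_times e0.
  pose t := Num.min (e / 2) (r / (2 * (`|v| + 1))).
  have v1 : 0 < `|v| + 1 by rewrite ltr_wpDl.
  have t0 : 0 < t by rewrite lt_min !divr_gt0 // mulr_gt0.
  have te : t < e by rewrite gt_min ltr_pdivrMr // ltr_pMr // ltr1n.
  have tr : `|t *: v| < r.
    rewrite normrZ gtr0_norm //; apply: (@le_lt_trans _ _ (r / 2)); last first.
      by rewrite ltr_pdivrMr // ltr_pMr // ltr1n.
    apply: (@le_trans _ _ (r / (2 * (`|v| + 1)) * `|v|)).
      by rewrite ler_wpM2r // ge_min lexx orbT.
    rewrite invfM mulrA -mulrA ler_piMr ?divr_ge0 ?(ltW r0) //.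
    by rewrite ler_pdivrMl // mulr1 lerDl.
  have [c ce tc] := small _ tr; exists (t, c) => //.
  by rewrite prod_normE /= gt_max lt_max normr_gt0 gt_eqF //= gtr0_norm // te.
have [p p1 Gp] := closed_subgroup_line cS clG G0 GD GN Gsmall.
case: p p1 Gp => t c p1 Gp.
have t0 : t != 0.
  apply/eqP => t0; have c0 : c = 0.
    apply: noline => s; have := Gp s.
    by rewrite /G /= t0 scaler0 scale0r (act0 actPsi).
  by move/eqP: p1; rewrite t0 c0 prod_normE /= !normr0 maxxx eq_sym oner_eq0.
(* The point of the line with first coordinate [s] has parameter [s / t]. *)
exists (t^-1 *: c) => s; have := Gp (s / t); rewrite /G /=.
by rewrite scalerA -[_ *: t]/(_ * t) divfK.
Qed.

(** By commutation the pairs [(u, c)] with [Psi u x = Phi c x] are stable under addition, so the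
    exponents of the basis vectors assemble linearly. *)
Lemma exponent_matrix : exists B : 'M[R]_d, forall v, Psi v x = Phi (B *m v) x.
Proof.
have [alpha alphaE] := choice (fun j => one_parameter_exponent (delta_mx j 0)).
exists (\matrix_(i, j) alpha j i 0) => v.
have -> : (\matrix_(i, j) alpha j i 0) *m v = \sum_j v j 0 *: alpha j.
  apply/matrixP => i k; rewrite !ord1 mxE summxE; apply: eq_bigr => j _.
  by rewrite !mxE mulrC.
rewrite [in LHS](col_sum_delta v).
apply: (big_ind2 (fun u c => Psi u x = Phi c x)).
- by rewrite (act0 actPhi) (act0 actPsi).
- move=> u c u' c' uc uc'.
  by rewrite (actD actPsi) uc' -comm uc -(actD actPhi) addrC.
- by move=> j _; exact: alphaE.
Qed.

(** Scaling [v] shows that every multiple of [B *m v - B' *m v] stabilises [x], so this difference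
    vanishes. *)
Lemma exponent_matrix_unique (B B' : 'M[R]_d) :
  (forall v, Phi (B *m v) x = Phi (B' *m v) x) -> B = B'.
Proof.
move=> BB'; have Bv (v : 'cV[R]_d) : B *m v = B' *m v.
  suff E : B *m v - B' *m v = 0 by apply/eqP; rewrite -subr_eq0 E.
  apply: noline => t.
  rewrite scalerBr !scalemxAr [B *m _ - _]addrC (actD actPhi) BB'.
  exact: actNK.
apply/matrixP => i j.
have := congr1 (fun C : 'cV[R]_d => C i 0) (Bv (delta_mx j 0)).
by rewrite /= -!colE !mxE.
Qed.

Lemma exponent_matrix_continuous (A : M -> 'M[R]_d) :
  (forall y v, Psi v y = Phi (A y *m v) y) -> {for x, continuous A}.
Proof.
move=> AE; have [r r0 disc] := stabilizer_discrete actPhi hM noline.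
move=> V /nbhs_ballP[e /= e0 Ve].
(* Below [r], so that no vector of norm [s] stabilises [x]; below [e], for the final estimate. *)
pose s := Num.min e r / 2.
have s0 : 0 < s by rewrite divr_gt0 // lt_min e0.
have /andP[se sr] : (s < e) && (s < r).
  by rewrite -lt_min ltr_pdivrMr // ltr_pMr ?ltr1n // lt_min e0.
pose K := [set w : 'cV[R]_d | `|w| <= 1] `*` [set c : 'cV[R]_d | `|c| = s].
have cK : compact K.
  apply: compact_setX; first exact: compact_norm_le.
  by apply: compact_norm_eq (lexx s) _; exact: compact_norm_le.
(* On [K] the points [Phi (A x w + c) x] and [Psi w x] differ because [c] is too
   small to stabilise [x]; so for [y] near [x] the vector [(A y - A x) w] avoids
   the norm [s] for all [w] of norm at most 1, and by scaling is shorter. *)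
have : \forall y \near x,
    K `<=` (fun p => Phi (A x *m p.1 + p.2) y <> Psi p.1 y).
  apply: (iffLR (compact_near_coveringP _) cK) => -[w c] [_ /= cs].
  suff : \forall q \near ((w, c), x),
      Phi (A x *m q.1.1 + q.1.2) q.2 <> Psi q.1.1 q.2.
    by apply: filterS => -[[? ?] ?].
  apply: (@near_neq _ _
    (fun q : ('cV[R]_d * 'cV[R]_d) * M => Phi (A x *m q.1.1 + q.1.2) q.2)
    (fun q => Psi q.1.1 q.2)) => //=.
  - apply: (act_cvg actPhi); last exact: cvg_snd.
    apply: cvgD; last by apply: cvg_comp; [exact: cvg_fst|exact: cvg_snd].
    apply: (@cvg_comp _ _ _ (fun q : ('cV[R]_d * 'cV[R]_d) * M => q.1.1)
      (fun w => A x *m w) _ (nbhs w)); last exact: mulmx_continuous.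
    by apply: cvg_comp; [exact: cvg_fst|exact: cvg_fst].
  - apply: (act_cvg actPsi); last exact: cvg_snd.
    by apply: cvg_comp; [exact: cvg_fst|exact: cvg_fst].
  - rewrite addrC (actD actPhi) -AE comm => cx.
    have c0 : c = 0.
      apply: disc; last by rewrite cs.
      by rewrite -[LHS](actNK actPsi w) cx (actNK actPsi).
    by move: s0; rewrite -cs c0 normr0 ltxx.
apply: filterS => y Ky; apply: Ve; rewrite -ball_normE /=.
have small (w : 'cV[R]_d) : `|w| <= 1 -> `|(A y - A x) *m w| < s.
  move=> w1; rewrite ltNge; apply/negP => sw.
  pose D := A y - A x; pose l := s / `|D *m w|.
  have Dw0 : 0 < `|D *m w| by exact: lt_le_trans sw.
  have l0 : 0 <= l by rewrite divr_ge0 // ltW.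
  apply: (Ky (l *: w, l *: (D *m w))).
    split => /=; rewrite normrZ ger0_norm //; last first.
      by rewrite /l divfK // gt_eqF.
    by rewrite mulr_ile1 // ler_pdivrMr // mul1r.
  by rewrite /= AE -scalemxAr -scalerDr -mulmxDl /D subrKC scalemxAr.
apply: le_lt_trans se; apply: mx_norm_le => [|i j]; first exact: ltW.
have -> : `|(A x - A y) i j| = `|((A y - A x) *m delta_mx j 0 : 'cV[R]_d) i 0|.
  by rewrite -colE !mxE distrC.
apply: le_trans (mx_entry_le _ _ _) _; apply/ltW/small.
apply: mx_norm_le => // a b; rewrite mxE.
by case: (_ && _); rewrite ?normr1 ?normr0.
Qed.

End point.

Lemma centralizer_quasi_trivial :
  (forall x v, orbit_of Phi x (Psi v x)) ->
  (forall x u, (forall t : R, Phi (t *: u) x = x) -> u = 0) ->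
  exists A : M -> 'M[R]_d,
    [/\ continuous A, (forall v x, A x = A (Phi v x)) &
        (forall v x, Psi v x = Phi (A x *m v) x)].
Proof.
move=> orb noline.
have [A AE] := choice (fun x => exponent_matrix (orb x) (noline x)).
exists A; split => [x|v x|v x]; last exact: AE.
  exact: (exponent_matrix_continuous (noline x) AE).
(* Commutation makes [A x] an exponent matrix at [Phi v x] as well. *)
apply: (exponent_matrix_unique (noline (Phi v x))) => w.
by rewrite -AE -comm AE -!(actD actPhi) addrC.
Qed.

End centralizer.

(** * Preservation of orbits by the centralizer *)

(** By compactness one radius [r] makes [Psi u] move every point by less than [delta], in particular
    every point of a [Phi]-orbit; commutation turns this into the premise of separation. A large [v]
    is split into [k] equal steps. *)
Lemma centralizer_preserves_orbits (R : realType) (d n : nat)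
    (M : topologicalType) (A : manifold R n None M) (g : riemannian_metric A)
    (Phi Psi : 'cV[R]_d -> M -> M) (x : M) (v : 'cV[R]_d) :
  compact [set: M] -> continuous_action Phi -> separating g Phi ->
  continuous_action Psi -> (forall u v x, Phi v (Psi u x) = Psi u (Phi v x)) ->
  orbit_of Phi x (Psi v x).
Proof.
move=> cM actPhi [delta [delta0 sep]] actPsi comm.
have : \forall u \near (0 : 'cV[R]_d), [set: M] `<=`
    (fun y => (riemannian_dist g y (Psi u y) < delta%:E)%E).
  apply: ((compact_near_coveringP _).1 cM _ (nbhs (0 : 'cV[R]_d))
    (fun u y => (riemannian_dist g y (Psi u y) < delta%:E)%E)
    (nbhs_filter _)) => p _.
  have [U Up Usmall] := riemannian_dist_locally_small g p delta0.
  have : \forall q \near (p, (0 : 'cV[R]_d)), U q.1 /\ U (Psi q.2 q.1).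
    apply: filterI.
      by apply: (@cvg_fst _ _ (nbhs p) (nbhs (0 : 'cV[R]_d))).
    have : (fun q : M * 'cV[R]_d => Psi q.2 q.1) @ nbhs (p, 0) --> Psi 0 p.
      by apply: (act_cvg actPsi); [exact: cvg_snd|exact: cvg_fst].
    by rewrite (act0 actPsi); apply.
  by apply: filterS => -[y u] /= [Uy Uuy]; exact: Usmall.
move=> /nbhs_ballP[r /= r0 Br].
have small u : `|u| < r -> forall y, orbit_of Phi y (Psi u y).
  move=> ur y; apply: sep => w; rewrite comm; apply: (Br u) => //.
  by rewrite -ball_normE /= sub0r normrN.
have multiples (k : nat) u : `|u| < r -> orbit_of Phi x (Psi (k%:R *: u) x).
  move=> ur; elim: k => [|k [c _ ck]].
    by exists 0 => //; rewrite scale0r (act0 actPhi) (act0 actPsi).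
  have [b _ bE] := small u ur (Phi c x).
  exists (b + c) => //; rewrite (actD actPhi) bE.
  by rewrite -natr1 scalerDl scale1r addrC (actD actPsi) ck.
pose k := (Num.truncn (`|v| / r)).+1.
have k0 : 0 < k%:R :> R by rewrite ltr0n.
have := multiples k (k%:R^-1 *: v).
rewrite scalerA divff ?gt_eqF // scale1r; apply.
rewrite normrZ normfV ger0_norm // ltr_pdivrMl // -ltr_pdivrMr //.
exact: truncnS_gt.
Qed.

Theorem theoremB (R : realType) (d n : nat) (M : topologicalType)
    (A : manifold R n None M) (g : riemannian_metric A)
    (Phi : 'cV[R]_d -> M -> M) :
  compact [set: M] ->
  C1_action A Phi ->
  (d <= n)%N ->
  separating g Phi ->
  homogeneous A Phi ->
  quasi_trivial Phi (centralizer0 Phi).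
Proof.
move=> cM C1Phi _ sep homog Psi [actPsi comm].
have [actPhi _] := C1Phi.
have commE u v x : Phi v (Psi u x) = Psi u (Phi v x).
  exact: (congr1 (fun f => f x) (comm u v)).
apply: centralizer_quasi_trivial => //; first exact: hausdorffM A.
  by move=> x v; exact: (centralizer_preserves_orbits x v cM actPhi sep).
by move=> x u; exact: stabilizer_no_line C1Phi (homog x).
Qed.
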